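(* Let $W$ be a finite-dimensional complex vector space. Every nil-polynomial $P\in\mathbb{C}[W]$ is uniquely determined by its quadratic and cubic terms; that is, if $P,\tilde P\in\mathbb{C}[W]$ are nil-polynomials with $P^{[2]}=\tilde P^{[2]}$ and $P^{[3]}=\tilde P^{[3]}$, then $P=\tilde P$.
   Context: All algebras are over $\mathbb{C}$. A finite-dimensional commutative associative algebra $\mathcal{N}$ is nilpotent if $\mathcal{N}^{\nu+1}=0$ for some $\nu\ge 0$, where $\mathcal{N}^1:=\mathcal{N}$ and $\mathcal{N}^{j+1}$ is the linear span of $\mathcal{N}\,\mathcal{N}^j$. It is admissible if it is nilpotent and its annihilator $\mathrm{Ann}(\mathcal{N}):=\{u\in\mathcal{N}:u\,\mathcal{N}=0\}$ has dimension 1. For $u\in\mathcal{N}$ put $\exp_2(u):=\sum_{m\ge 2}\frac{u^m}{m!}$ (a finite sum). For a finite-dimensional complex vector space $W$, $\mathbb{C}[W]$ is the algebra of complex-valued polynomials on $W$. A polynomial $P\in\mathbb{C}[W]$ is a nil-polynomial if there exist an admissible algebra $\mathcal{N}$, a linear form $\omega:\mathcal{N}\to\mathbb{C}$ with $\omega(\mathrm{Ann}(\mathcal{N}))=\mathbb{C}$ and a linear isomorphism $\varphi:W\to\ker\omega$ such that $P=\omega\circ\exp_2\circ\varphi$. $P^{[\ell]}$ denotes the homogeneous component of degree $\ell$ of $P$. *)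

(* Defs.v *)
From HB Require Import structures.
From mathcomp Require Import all_boot all_order all_algebra.
From mathcomp Require Import reals complex mpoly.

Set Implicit Arguments.
Unset Strict Implicit.
Unset Printing Implicit Defensive.

Import Order.TTheory GRing.Theory Num.Theory.
Local Open Scope ring_scope.

(** Finite-dimensional commutative associative algebras.  MathComp's algebra
    structures all have a unit, which a nonzero nilpotent algebra cannot have,
    so the product [amul] is put directly on a [vectType]. *)

HB.mixin Record hasComAssocMul (K : fieldType) N of Vector K N := {
  amul : N -> N -> N;
  amul_linear : forall u, linear (amul u);
  amulC : commutative amul;
  amulA : associative amul
}.

#[short(type="comAssocAlgType")]
HB.structure Definition ComAssocAlg (K : fieldType) :=
  { N of hasComAssocMul K N & Vector K N }.

Section Algebra.
Variables (K : fieldType) (N : comAssocAlgType K).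
Implicit Types (u v w : N) (U V W : {vspace N}) (j m : nat).

HB.instance Definition _ u :=
  GRing.isLinear.Build K N N *:%R (amul u) (amul_linear u).

(** Linear span of all products [amul u v], [u \in U], [v \in V]
    (see [aprodP]). *)
Definition aprod U V : {vspace N} :=
  <<[seq amul u v | u <- vbasis U, v <- vbasis V]>>%VS.

(** [apow j] is the j-th power of the algebra, for [0 < j]. *)
Definition apow j : {vspace N} := iter j.-1 (aprod fullv) fullv.

Definition nilpotent_alg : Prop := exists nu, apow nu.+1 = 0%VS.

(** [u \in Ann] iff [u] kills the whole algebra (see [AnnP]). *)
Definition Ann : {vspace N} :=
  (\bigcap_(i < \dim {:N}) lker (linfun (amul (vbasis {:N})`_i)))%VS.

Definition admissible : Prop := nilpotent_alg /\ \dim Ann = 1%N.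

(** m-th power of an element, for [0 < m]. *)
Definition npow u m : N := iter m.-1 (amul u) u.

(** The sum of all [u ^ m / m!], [2 <= m]: in a nilpotent algebra the powers
    beyond the dimension vanish (see [npow_eq0] and [exp2E]). *)
Definition exp2 u : N :=
  \sum_(2 <= m < (\dim {:N}).+1) (m`!%:R)^-1 *: npow u m.

Lemma amulDl u v w : amul (u + v) w = amul u w + amul v w.
Proof. by rewrite !(amulC _ w) linearD. Qed.

Lemma amulZl a u w : amul (a *: u) w = a *: amul u w.
Proof. by rewrite !(amulC _ w) linearZ. Qed.

Lemma amul0l w : amul 0 w = 0.
Proof. by rewrite amulC linear0. Qed.

Lemma amul_suml (I : Type) (r : seq I) (P : pred I) (F : I -> N) w :
  amul (\sum_(i <- r | P i) F i) w = \sum_(i <- r | P i) amul (F i) w.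
Proof.
by elim/big_rec2: _ => [|i x y _ <-]; rewrite ?amul0l ?amulDl.
Qed.

Lemma mem_aprod U V u v : u \in U -> v \in V -> amul u v \in aprod U V.
Proof.
move=> /coord_vbasis-> /coord_vbasis->; rewrite amul_suml.
apply: memv_suml => i _; rewrite linear_sum /=.
apply: memv_suml => j _; rewrite amulZl linearZ /=; do 2!apply: memvZ.
apply: memv_span; by apply: allpairs_f; apply: mem_nth; rewrite size_tuple.
Qed.

Lemma aprodP U V W :
  reflect (forall u v, u \in U -> v \in V -> amul u v \in W) (aprod U V <= W)%VS.
Proof.
apply: (iffP idP) => [sUVW u v Uu Vv | sUVW].
  exact: subvP sUVW _ (mem_aprod Uu Vv).
apply/span_subvP => _ /allpairsP[[u v] /= [Uu Vv ->]].
by apply: sUVW; apply: vbasis_mem.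
Qed.

Lemma AnnP u : reflect (forall v, amul u v = 0) (u \in Ann).
Proof.
apply: (iffP idP) => [Au v | Au].
  rewrite (coord_vbasis (memvf v)) linear_sum big1 // => i _.
  rewrite linearZ /= amulC.
  have /subvP/(_ u Au) : (Ann <= lker (linfun (amul (vbasis {:N})`_i)))%VS.
    by rewrite /Ann (bigD1 i) //= capvSl.
  by rewrite memv_ker lfunE => /eqP ->; rewrite scaler0.
rewrite memvE; apply/subv_bigcapP => i _.
by rewrite -memvE memv_ker lfunE /= amulC Au.
Qed.

Lemma mem_npow u m : npow u m \in apow m.
Proof.
rewrite /npow /apow; elim: m.-1 => [|n IH] /=; first exact: memvf.
by apply: mem_aprod; rewrite ?memvf.
Qed.

Lemma apow_sub j : (apow j.+2 <= apow j.+1)%VS.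
Proof.
elim: j => [|j IH]; first exact: subvf.
apply/aprodP => u v uN vj; apply: (mem_aprod uN); exact: subvP IH _ vj.
Qed.

Lemma apow_dim j : nilpotent_alg -> (\dim (apow j.+1) <= \dim {:N} - j)%N.
Proof.
case=> nu nu0; elim: j => [|j IH]; first by rewrite subn0 dimvS ?subvf.
have [eqj|neqj] := eqVneq (apow j.+2) (apow j.+1).
  have const k : apow (j + k).+1 = apow j.+1.
    elim: k => [|k IHk]; rewrite ?addn0 // addnS.
    by rewrite -[LHS]/(aprod fullv (apow (j + k).+1)) IHk.
  suff -> : apow j.+2 = 0%VS by rewrite dimv0.
  rewrite eqj -(const nu); apply/eqP; rewrite -subv0 -nu0 (addnC j).
  elim: {IH eqj const} j => [|j IHj]; first by rewrite addn0 subvv.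
  by rewrite addnS; apply: subv_trans (apow_sub _) IHj.
have lt : (\dim (apow j.+2) < \dim (apow j.+1))%N.
  rewrite ltn_neqAle dimvS ?apow_sub // andbT.
  by apply: contra neqj => /eqP e; rewrite eqEdim apow_sub e leqnn.
by rewrite subnS -ltnS; case: (_ - _)%N IH => [|k] /= /(leq_trans lt).
Qed.

Lemma npow_eq0 u m : nilpotent_alg -> (\dim {:N} < m)%N -> npow u m = 0.
Proof.
case: m => // m nilN ltm; have := mem_npow u m.+1.
have := apow_dim m nilN; rewrite (eqnP (_ : \dim {:N} - m == 0)%N) //.
by rewrite leqn0 dimv_eq0 => /eqP ->; rewrite memv0 => /eqP.
Qed.

Lemma exp2E n u : nilpotent_alg -> (\dim {:N} < n)%N ->
  exp2 u = \sum_(2 <= m < n) (m`!%:R)^-1 *: npow u m.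
Proof.
move=> nilN ltn; rewrite /exp2; have [le2|lt2] := leqP 2 (\dim {:N}).+1.
  rewrite [RHS](big_cat_nat le2 ltn) /= [X in _ + X]big_nat.
  rewrite [X in _ + X]big1 ?addr0 // => m /andP[ltm _].
  by rewrite npow_eq0 ?scaler0.
rewrite big_geq 1?ltnW // big_nat big1 // => m /andP[lem _].
by rewrite npow_eq0 ?scaler0 //; apply: leq_trans lem; rewrite ltnW.
Qed.

End Algebra.

Arguments nilpotent_alg {K} N.
Arguments Ann {K} N.
Arguments admissible {K} N.
Arguments apow {K} N j.

Section Polynomials.
Variables (K : fieldType) (W : vectType K).

(** Polynomials on [W], written in the coordinates of the basis
    [vbasis {:W}].  In characteristic 0 they are the same as polynomial
    functions on [W] (see [peval_inj]), and their homogeneous components do not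
    depend on the basis (see [peval_hcompZ]). *)
Definition polyOn := {mpoly K[\dim {:W}]}.

Definition peval (P : polyOn) (w : W) : K :=
  P.@[fun i => coord (vbasis {:W}) i w].

Definition hcomp (l : nat) (P : polyOn) : polyOn := pihomog mdeg l P.

Definition nil_polynomial (P : polyOn) : Prop :=
  exists (N : comAssocAlgType K) (omega : 'Hom(N, K^o))
         (phi : 'Hom(W, subvs_of (lker omega))),
    [/\ admissible N,
        (omega @: Ann N)%VS = fullv,
        bijective phi
      & forall w : W, peval P w = omega (exp2 (vsval (phi w)))].

End Polynomials.

Lemma peval_hcompZ (K : fieldType) (W : vectType K) l (P : polyOn W) a w :
  peval (hcomp l P) (a *: w) = a ^+ l * peval (hcomp l P) w.
Proof.
rewrite /peval /hcomp pihomogE !raddf_sum /= mulr_sumr.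
apply: eq_bigr => m /eqP <-; rewrite !mevalZ !mevalX mulrCA; congr (_ * _).
rewrite mdegE -prodrXr -big_split /=; apply: eq_bigr => i _.
by rewrite linearZ /= exprMn.
Qed.

Lemma horner_eq0 (K : numFieldType) (p : {poly K}) :
  (forall x, p.[x] = 0) -> p = 0.
Proof.
move=> p0; apply/eqP; apply: contraT => pn0.
pose rs : seq K := [seq i%:R | i <- iota 0 (size p)].
have rs_uniq : uniq rs.
  by rewrite map_inj_uniq ?iota_uniq // => i j /eqP; rewrite eqr_nat => /eqP.
have rs_roots : all (root p) rs by apply/allP => x _; rewrite /root p0.
have := max_poly_roots pn0 rs_roots rs_uniq.
by rewrite size_map size_iota ltnn.
Qed.

Lemma muni_coeff (K : fieldType) n (p : {mpoly K[n.+1]}) k m :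
  ((muni p)`_k)@_m =
  \sum_(m' <- msupp p | (m' ord_max == k) &&
     ([multinom m' (widen_ord (leqnSn n) i) | i < n] == m)) p@_m'.
Proof.
rewrite muniE coef_sum raddf_sum /= big_mkcond [RHS]big_mkcond /=.
apply: eq_bigr => m' _; rewrite coefZ coefXn eq_sym.
case: eqP => _ /=; last by rewrite mulr0 mcoeff0.
by rewrite mulr1 mcoeffZ mcoeffX; case: eqP => _; rewrite ?mulr1 ?mulr0.
Qed.

Lemma muni_eq0 (K : fieldType) n (p : {mpoly K[n.+1]}) : muni p = 0 -> p = 0.
Proof.
move=> p0; apply/mpolyP => m; rewrite mcoeff0.
have := muni_coeff p (m ord_max)
  [multinom m (widen_ord (leqnSn n) i) | i < n].
rewrite p0 coef0 mcoeff0 (eq_bigl (pred1 m)) => [|m' /=]; last first.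
  apply/andP/eqP => [[/eqP em /eqP/mnmP ew]|-> //].
  apply/mnmP => i; have [j ->|->] := unliftP ord_max i; last exact: em.
  have -> : lift ord_max j = widen_ord (leqnSn n) j.
    by apply/val_inj => /=; rewrite /bump leqNgt ltn_ord.
  by have := ew j; rewrite !mnmE.
have [mp|/memN_msupp_eq0 -> //] := boolP (m \in msupp p).
by rewrite -big_filter filter_pred1_uniq ?msupp_uniq // big_seq1.
Qed.

Lemma meval_muni (K : fieldType) n (p : {mpoly K[n.+1]}) v :
  p.@[v] =
  (map_poly (meval (fun i => v (widen_ord (leqnSn n) i))) (muni p)).[v ord_max].
Proof.
rewrite muniE mevalE raddf_sum horner_sum; apply: eq_bigr => m _ /=.
rewrite map_polyZ /= map_polyXn hornerZ hornerXn mevalZ mevalX big_ord_recr /=.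
by rewrite mulrA; congr (_ * _ * _); apply: eq_bigr => i _; rewrite mnmE.
Qed.

Lemma meval_eq0 (K : numFieldType) n (p : {mpoly K[n]}) :
  (forall v : 'I_n -> K, p.@[v] = 0) -> p = 0.
Proof.
elim: n p => [|n IH] p p0.
  have := p0 (fun _ => 0); rewrite mevalE => p00; apply/mpolyP => m.
  rewrite mcoeff0; have m0 (m1 : 'X_{1..0}) : m1 = m by apply/mnmP; case.
  have [mp|/memN_msupp_eq0 -> //] := boolP (m \in msupp p).
  have := p00; rewrite (bigD1_seq m) ?msupp_uniq //= big_ord0 mulr1.
  by rewrite big1 ?addr0 // => m1; rewrite (m0 m1) eqxx.
apply/muni_eq0/polyP => k; rewrite coef0; apply: IH => v.
suff q0 : map_poly (meval v) (muni p) = 0.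
  by have := coef_map (meval v) (muni p) k; rewrite q0 coef0.
apply: horner_eq0 => x.
pose v' i := if unlift ord_max i is Some j then v j else x.
have := p0 v'; rewrite meval_muni /v' unlift_none => <-.
congr (_.[_]); apply: eq_map_poly => q; apply: meval_eq => i.
have -> : widen_ord (leqnSn n) i = lift ord_max i.
  by apply/val_inj => /=; rewrite /bump leqNgt ltn_ord.
by rewrite liftK.
Qed.

Lemma peval_inj (K : numFieldType) (W : vectType K) (P Q : polyOn W) :
  peval P =1 peval Q -> P = Q.
Proof.
move=> ePQ; apply/eqP; rewrite -subr_eq0; apply/eqP/meval_eq0 => v.
have := ePQ (\sum_i v i *: (vbasis {:W})`_i); rewrite /peval => e.
rewrite mevalB; apply/eqP; rewrite subr_eq0; apply/eqP; move: e.
have ev : (fun i => coord (vbasis {:W}) i (\sum_i v i *: (vbasis {:W})`_i)) =1 v.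
  by move=> i; rewrite coord_sum_free // (basis_free (vbasisP _)).
by rewrite !(meval_eq _ ev).
Qed.

(* Main.v *)
Require Import Defs.
From mathcomp Require Import all_boot all_order all_algebra.
From mathcomp Require Import reals complex.
From mathcomp Require Import ring.
From mathcomp Require Import mpoly.

Import Order.TTheory GRing.Theory Num.Theory.

Local Open Scope ring_scope.
Local Open Scope complex_scope.

(** Let [N] be admissible, [omega] a linear form that does not vanish on the
    annihilator, and [f] a linear bijection from [W] onto [lker omega]. The
    component of degree [l >= 2] of the nil-polynomial is
    [omega (f w ^ l) / l!] ([hcomp_npow]), so by polarization its quadratic and
    cubic components determine the forms [b u v = omega (f u f v)] and
    [t u v w = omega (f u f v f w)] on [W].

    The algebra is the direct sum of [lker omega] and its annihilator, hence
    [W] carries a commutative product [u . v] with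
    [f (u . v) = f u f v] modulo the annihilator. This product satisfies
    [b (u . v) w = t u v w], because the annihilator does not contribute to
    products. The form [b] is nondegenerate ([lker_nondegenerate]): its radical
    would give an ideal inside [lker omega], and every nonzero ideal of a
    nilpotent algebra meets the annihilator ([ideal_lker_eq0]). Therefore [b]
    and [t] determine the product on [W], and with it all the values
    [omega (f w ^ l) = b w (w . (w . ...))], that is, the whole polynomial.

    The product on [W] stays implicit: for two nil-polynomials with the same
    [b] and [t], the powers of [f w] and of [f' w] are represented, modulo the
    annihilators, by a common element of [W] ([npow_mod_Ann]). *)

Set Implicit Arguments.
Unset Strict Implicit.
Unset Printing Implicit Defensive.

(** * Polarization *)

Section Polarization.
Variables (K : numFieldType) (V : zmodType).

Lemma polarization2 (B : V -> V -> K) :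
    (forall u v, B u v = B v u) ->
    (forall u v w, B (u + v) w = B u w + B v w) ->
    (forall u, B u u = 0) ->
  forall u v, B u v = 0.
Proof.
move=> symB addB B0 u v; have n2 : 2%:R != 0 :> K by rewrite pnatr_eq0.
apply: (mulfI n2); rewrite mulr0.
have addBr x y z : B x (y + z) = B x y + B x z by rewrite symB addB !(symB x).
rewrite -(B0 (u + v)) addB !addBr !B0 (symB v u); ring.
Qed.

(** Inclusion-exclusion on the values of the cubic form at the sums of subsets
    of [u], [v], [w] gives [6 * T u v w]. *)
Lemma polarization3 (T : V -> V -> V -> K) :
    (forall u v w, T u v w = T v u w) ->
    (forall u v w, T u v w = T u w v) ->
    (forall u v w z, T (u + v) w z = T u w z + T v w z) ->
    (forall u, T u u u = 0) ->
  forall u v w, T u v w = 0.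
Proof.
move=> T12 T23 addT T0 u v w; have n6 : 6%:R != 0 :> K by rewrite pnatr_eq0.
apply: (mulfI n6); rewrite mulr0.
have addT2 x y z t : T x (y + z) t = T x y t + T x z t.
  by rewrite T12 addT !(T12 x).
have addT3 x y z t : T x y (z + t) = T x y z + T x y t.
  by rewrite T23 addT2 !(T23 x y).
have <- : T (u + v + w) (u + v + w) (u + v + w)
    - T (u + v) (u + v) (u + v) - T (v + w) (v + w) (v + w)
    - T (u + w) (u + w) (u + w) + T u u u + T v v v + T w w w = 0.
  by rewrite !T0 !subr0 !addr0.
rewrite !(addT, addT2, addT3).
(* Symmetry identifies the values of [T] on reorderings of the same arguments;
   what remains is linear in the distinct values. *)
rewrite (T12 v u w) (T12 w u v) (T12 w v u) (T23 v w u) (T12 v u w) (T23 u w v).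
ring.
Qed.

End Polarization.

(** * Homogeneous components and powers *)

Lemma amulBl (K : fieldType) (N : comAssocAlgType K) (u v w : N) :
  amul (u - v) w = amul u w - amul v w.
Proof. by rewrite !(amulC _ w) linearB. Qed.

Section NilPolynomial.
Variables (K : numFieldType) (W : vectType K).

Lemma npowZ (N : comAssocAlgType K) (a : K) (u : N) m :
  npow (a *: u) m.+1 = a ^+ m.+1 *: npow u m.+1.
Proof.
rewrite /npow /=; elim: m => [|m IH] /=; first by rewrite expr1.
by rewrite IH amulZl linearZ scalerA -exprS.
Qed.

Lemma nil_polynomial_lker (P : polyOn W) : nil_polynomial P ->
  exists (N : comAssocAlgType K) (omega : 'Hom(N, K^o)) (f : 'Hom(W, N)),
    [/\ admissible N, (omega @: Ann N)%VS = fullv, limg f = lker omega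
      & forall w, peval P w = omega (exp2 (f w))].
Proof.
case=> N [omega [phi [admN omegaA [psi phiK psiK] Pphi]]].
exists N, omega, (linfun (vsval \o phi)); split=> //; last first.
  by move=> w; rewrite lfunE; apply: Pphi.
apply/vspaceP => u; apply/memv_imgP/idP => [[w _ ->]|uker].
  by rewrite lfunE /= subvsP.
by exists (psi (Subvs uker)); rewrite ?memvf // lfunE /= psiK.
Qed.

Lemma omega_exp2E (N : comAssocAlgType K) (omega : 'Hom(N, K^o)) n u :
    nilpotent_alg N -> (\dim {:N} < n)%N ->
  omega (exp2 u) = \sum_(2 <= m < n) (m`!%:R)^-1 * omega (npow u m).
Proof.
move=> nilN ltn; rewrite (exp2E u nilN ltn) linear_sum.
by apply: eq_bigr => m _; rewrite linearZ.
Qed.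

(** For fixed [w], both sides of [peval P (x *: w) = omega (exp2 (x *: f w))]
    are polynomials in the scalar [x]; in characteristic 0 their coefficients
    agree, and the coefficient of [x ^+ l] is the component of degree [l]. *)
Lemma hcomp_npow (N : comAssocAlgType K) (omega : 'Hom(N, K^o))
    (f : 'Hom(W, N)) (P : polyOn W) l w :
    nilpotent_alg N -> (forall w, peval P w = omega (exp2 (f w))) ->
  (1 < l)%N -> peval (hcomp l P) w = (l`!%:R)^-1 * omega (npow (f w) l).
Proof.
move=> nilN Pf l1.
(* [n] bounds the degrees of both polynomials in [x] and exceeds [l]. *)
pose n := maxn (msize P) (maxn (\dim {:N}).+1 l.+1).
have Pn : (msize P <= n)%N by rewrite leq_maxl.
have Nn : (\dim {:N} < n)%N by rewrite /n !leq_max leqnn orbT.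
have ln : (l < n)%N by rewrite /n !leq_max leqnn !orbT.
pose c m := if (1 < m)%N then (m`!%:R)^-1 * omega (npow (f w) m) else 0.
have /polyP/(_ l) : \poly_(m < n) (peval (hcomp m P) w - c m) = 0 :> {poly K}.
  apply: horner_eq0 => x; rewrite horner_poly.
  under eq_bigr do rewrite mulrBl; rewrite sumrB.
  have -> : \sum_(m < n) peval (hcomp m P) w * x ^+ m = peval P (x *: w).
    rewrite {2}(pihomog_partitionE Pn) /peval raddf_sum /=.
    by apply: eq_bigr => m _; rewrite mulrC -peval_hcompZ.
  have -> : \sum_(m < n) c m * x ^+ m = omega (exp2 (x *: f w)).
    rewrite (omega_exp2E _ _ nilN Nn) -(big_mkord xpredT (fun m => c m * x ^+ m)).
    rewrite (@big_cat_nat _ _ _ 2) //=; last exact: leq_trans l1 (ltnW ln).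
    rewrite [X in X + _]big_nat [X in X + _]big1 ?add0r => [|m /andP[_ m2]]; last first.
      by rewrite /c ltnNge -ltnS m2 mul0r.
    rewrite !big_nat; apply: eq_bigr => -[//|m] /andP[m1 _].
    by rewrite /c m1 npowZ linearZ /= mulrAC mulrA.
  by rewrite Pf linearZ subrr.
by rewrite coef_poly coef0 ln /c l1 => /subr0_eq.
Qed.

End NilPolynomial.

(** * The pairing on the kernel of the linear form *)

Section Admissible.
Variables (K : fieldType) (N : comAssocAlgType K) (omega : 'Hom(N, K^o)).
Hypotheses (admN : admissible N) (omegaA : (omega @: Ann N)%VS = fullv).

(** The annihilator is a line, which [omega] maps onto the ground field, hence
    bijectively. *)
Lemma Ann_lker u : u \in Ann N -> omega u = 0 -> u = 0.
Proof.
move=> uA u0; have := limg_ker_dim omega (Ann N).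
rewrite omegaA (proj2 admN) dimvf /= => /eqP.
rewrite -[X in _ == X]add0n eqn_add2r dimv_eq0 => /eqP A0.
by apply/eqP; rewrite -memv0 -A0 memv_cap uA memv_ker u0 eqxx.
Qed.

Lemma decomp_lker u : exists2 a, a \in Ann N & u - a \in lker omega.
Proof.
have /memv_imgP[a aA ua] : omega u \in (omega @: Ann N)%VS.
  by rewrite omegaA memvf.
by exists a; rewrite // memv_ker linearB /= ua subrr.
Qed.

(** The hypotheses say that the ideal generated by [u] lies in [lker omega].
    A nonzero ideal of a nilpotent algebra meets the annihilator, on which
    [omega] is injective. *)
Lemma ideal_lker_eq0 u :
  omega u = 0 -> (forall v, omega (amul u v) = 0) -> u = 0.
Proof.
case: admN => -[nu nu0] _.
suff E k v : v \in apow N (nu.+1 - k) -> omega v = 0 ->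
    (forall w, omega (amul v w) = 0) -> v = 0.
  by apply: (E nu.+1); rewrite subnn memvf.
(* Descending induction on the powers of the algebra: a product [amul v w]
   satisfies the same hypotheses one power further. *)
elim: k v => [|k IH] v; first by rewrite subn0 nu0 memv0 => /eqP.
move=> vk v0 vw0; apply: Ann_lker => //; apply/AnnP => w.
apply: IH => // [|t]; last by rewrite -amulA.
(* [apow N 0] and [apow N 1] are both the whole algebra. *)
have [lek|ltk] := leqP (nu.+1 - k) 1.
  by rewrite /apow; case: (_ - _)%N lek => [|[]]; rewrite ?memvf.
move: vk; rewrite subnS; case: (_ - _)%N ltk => [|[|j]] // _ vj.
by rewrite amulC; apply: mem_aprod; rewrite ?memvf.
Qed.

(** Since the algebra is the sum of [lker omega] and [Ann N], an element
    orthogonal to [lker omega] is orthogonal to everything, and so are its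
    multiples. *)
Lemma lker_nondegenerate u :
  (forall v, v \in lker omega -> omega (amul u v) = 0) -> u \in Ann N.
Proof.
move=> u0; have {}u0 v : omega (amul u v) = 0.
  have [a /AnnP aA va] := decomp_lker v.
  by rewrite -(subrK a v) linearD /= (amulC u a) aA addr0 u0.
by apply/AnnP => v; apply: ideal_lker_eq0 => // w; rewrite -amulA.
Qed.

End Admissible.

(** * Comparison of two admissible algebras *)

Section Transfer.
Variables (K : fieldType) (W : vectType K).
Variables (N N' : comAssocAlgType K).
Variables (omega : 'Hom(N, K^o)) (omega' : 'Hom(N', K^o)).
Variables (f : 'Hom(W, N)) (f' : 'Hom(W, N')).
Hypothesis omegaA : (omega @: Ann N)%VS = fullv.
Hypotheses (admN' : admissible N') (omegaA' : (omega' @: Ann N')%VS = fullv).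
Hypotheses (fK : limg f = lker omega) (fK' : limg f' = lker omega').
Hypothesis eq2 : forall u v,
  omega (amul (f u) (f v)) = omega' (amul (f' u) (f' v)).
Hypothesis eq3 : forall u v w,
  omega (amul (f u) (amul (f v) (f w))) =
  omega' (amul (f' u) (amul (f' v) (f' w))).

(** One and the same [x] represents the power modulo the annihilator in both
    algebras. In the step, [y] is chosen to represent the product
    [amul (f w) (f x)]: this gives the equality of
    [omega (amul (f y) (f t))] and [omega (amul (f w) (amul (f x) (f t)))] for
    all [t], which [eq2] and [eq3] carry over to the second algebra, where
    nondegeneracy turns it back into a congruence modulo the annihilator. *)
Lemma npow_mod_Ann w m : exists x,
  f x - npow (f w) m.+1 \in Ann N /\ f' x - npow (f' w) m.+1 \in Ann N'.
Proof.
rewrite /npow /=; elim: m => [|m [x [xA xA']]].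
  by exists w; rewrite !subrr !mem0v.
have [a aA aker] := decomp_lker omegaA (amul (f w) (f x)).
have /memv_imgP[y _ fy] : amul (f w) (f x) - a \in limg f by rewrite fK.
exists y; split.
  by rewrite -fy /= addrAC -linearB /= amulC (AnnP _ xA) sub0r rpredN.
rewrite -(subrKA (amul (f' w) (f' x))) rpredD // -?linearB /=; last first.
  by rewrite amulC (AnnP _ xA') mem0v.
apply: (lker_nondegenerate admN' omegaA') => v.
rewrite -fK' => /memv_imgP[t _ ->].
rewrite amulBl linearB /= -amulA -eq2 -eq3 amulA -linearB -amulBl /= -fy.
by rewrite addrAC subrr sub0r amulC linearN /= amulC (AnnP _ aA) oppr0 linear0.
Qed.

(** Multiplication by [f w] absorbs the error in the annihilator, so that
    [omega] of a power is a value of the quadratic pairing. *)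
Lemma transfer_npow w m : omega (npow (f w) m.+2) = omega' (npow (f' w) m.+2).
Proof.
have [x [xA xA']] := npow_mod_Ann w m.
have e : amul (f w) (npow (f w) m.+1) = amul (f w) (f x).
  by apply/esym/subr0_eq; rewrite -linearB /= amulC (AnnP _ xA).
have e' : amul (f' w) (npow (f' w) m.+1) = amul (f' w) (f' x).
  by apply/esym/subr0_eq; rewrite -linearB /= amulC (AnnP _ xA').
by rewrite -[npow (f w) _]/(amul _ (npow _ m.+1)) e eq2 -e'.
Qed.

End Transfer.

(** * Determination by the quadratic and cubic terms *)

Lemma nil_polynomial_hcomp23_inj (K : numFieldType) (W : vectType K)
    (P Q : polyOn W) :
    nil_polynomial P -> nil_polynomial Q ->
  hcomp 2 P = hcomp 2 Q -> hcomp 3 P = hcomp 3 Q -> P = Q.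
Proof.
move=> /nil_polynomial_lker[N [o [f [admN oA fK Pf]]]].
move=> /nil_polynomial_lker[N' [o' [f' [admN' oA' fK' Qf']]]] h2 h3.
have [nilN nilN'] := (proj1 admN, proj1 admN').
have eqpow l w : (1 < l)%N -> hcomp l P = hcomp l Q ->
    o (npow (f w) l) = o' (npow (f' w) l).
  move=> l1 hl; have nl : (l`!%:R)^-1 != 0 :> K.
    by rewrite invr_eq0 pnatr_eq0 -lt0n fact_gt0.
  by apply: (mulfI nl); rewrite -(hcomp_npow _ nilN Pf) // hl (hcomp_npow _ nilN' Qf').
have eq2 u v : o (amul (f u) (f v)) = o' (amul (f' u) (f' v)).
  apply/subr0_eq; move: u v; apply: polarization2 => [u v|u v w|u].
  - by rewrite amulC (amulC (f' u)).
  - by rewrite !linearD !amulDl !linearD /= addrACA.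
  - by apply/eqP; rewrite subr_eq0 -[amul (f u) _]/(npow _ 2) (eqpow 2%N).
have eq3 u v w : o (amul (f u) (amul (f v) (f w))) =
    o' (amul (f' u) (amul (f' v) (f' w))).
  apply/subr0_eq; move: u v w; apply: polarization3 => [u v w|u v w|u v w z|u].
  - by rewrite !amulA (amulC (f u)) (amulC (f' u)).
  - by rewrite (amulC (f v)) (amulC (f' v)).
  - by rewrite !linearD !amulDl !linearD /= addrACA.
  - by apply/eqP; rewrite subr_eq0 -[amul (f u) _]/(npow _ 3) (eqpow 3%N).
apply: peval_inj => w; rewrite Pf Qf'.
pose n := (maxn (\dim {:N}) (\dim {:N'})).+1.
rewrite (@omega_exp2E _ _ o n) ?(@omega_exp2E _ _ o' n) ?ltnS ?leq_maxl ?leq_maxr //.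
rewrite !big_nat; apply: eq_bigr => -[|[|m]] // _.
by rewrite (transfer_npow oA admN' oA' fK fK' eq2 eq3).
Qed.

Theorem corollary2p9 (R : realType) (W : vectType R[i]) (P Q : polyOn W)
  (hP : nil_polynomial P) (hQ : nil_polynomial Q)
  (h2 : hcomp 2 P = hcomp 2 Q) (h3 : hcomp 3 P = hcomp 3 Q) :
  P = Q.
Proof. exact: nil_polynomial_hcomp23_inj hP hQ h2 h3. Qed.
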